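(* Let $U$ be a nonempty finite set and let $\mathcal{D}\subseteq \mathrm{Part}(U)\setminus\{\triangle\}$ be a disjoint system. Then $\mathcal{D}_{\vee}\cup\{\triangle\}$ is a Boolean sublattice of $\mathrm{Part}(U)$ if and only if the hypergraph $\mathcal{H}(\mathcal{D})$ satisfies the circuit condition.
   Context: $\mathrm{Part}(U)$ is the lattice of all partitions of $U$ ordered by refinement ($\pi_1\le\pi_2$ iff every block of $\pi_2$ is a union of blocks of $\pi_1$); $\triangle$ is its least element (all blocks singletons). A Boolean sublattice is a sublattice (closed under meet and join of $\mathrm{Part}(U)$) that is itself a Boolean lattice. A disjoint system is a nonempty set $\mathcal{D}$ of partitions such that any two distinct members have meet $\triangle$. $\mathcal{D}_\vee$ is the set of all finite joins of elements of $\mathcal{D}$ (joins of nonempty finite subsets). $\mathcal{H}(\mathcal{D})$ is the hypergraph with vertex set $U$ whose edges are the non-singleton blocks of all partitions in $\mathcal{D}$. A path from $u$ to $v$ ($u\ne v$) is a sequence $u=v_0,A_1,v_1,A_2,\dots,v_{n-1},A_n,v_n=v$ ($n\ge1$) with $v_{i-1},v_i\in A_i$, where the vertices $v_0,\dots,v_n$ are distinct and the edges $A_1,\dots,A_n$ are distinct. Circuit condition: for any subsets $X,Y\subseteq\mathcal{D}$, any vertices $u\neq v$, and any two paths $u,A_1,v_1,\dots,v_{n-1},A_n,v$ and $u,B_1,w_1,\dots,w_{m-1},B_m,v$ in $\mathcal{H}(\mathcal{D})$ such that each $A_i$ is a block of some partition in $X$ and each $B_j$ is a block of some partition in $Y$,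 there exists a path $u,C_1,u_1,\dots,u_{k-1},C_k,v$ in $\mathcal{H}(\mathcal{D})$ such that each $C_i$ is a block of some partition in $X\cap Y$. *)

(* Defs.v *)
From HB Require Import structures.
From mathcomp Require Import all_boot all_order.

Set Implicit Arguments.
Unset Strict Implicit.
Unset Printing Implicit Defensive.

Import Order.Theory.

Local Open Scope order_scope.

Record part (U : finType) := Part {
  blocks :> {set {set U}};
  blocksP : partition blocks [set: U]
}.

HB.instance Definition _ (U : finType) := [isSub for @blocks U].
HB.instance Definition _ (U : finType) := [Finite of part U by <:].

Section PartitionLattice.

Context {U : finType}.
Implicit Types (p q r : part U) (x y z : U).

(* Every block of q is a union of blocks of p. *)
Definition refines p q : bool :=
  [forall B in blocks q,
     [exists C : {set {set U}}, (C \subset blocks p) && (B == cover C)]].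

Definition same_block p : rel U := fun x y => y \in pblock p x.

Lemma mem_cover_part p x : x \in cover p.
Proof. by rewrite (cover_partition (blocksP p)) inE. Qed.

Lemma part_trivIset p : trivIset p.
Proof. by case/and3P: (blocksP p). Qed.

Lemma same_block_equiv p : equivalence_rel (same_block p).
Proof.
move=> x y z; split; first by rewrite /same_block mem_pblock mem_cover_part.
by rewrite /same_block => /(same_pblock (part_trivIset p)) ->.
Qed.

Lemma same_block_refl p : reflexive (same_block p).
Proof. by move=> x; case: (same_block_equiv p x x x). Qed.

Lemma same_block_sym p : symmetric (same_block p).
Proof.
move=> x y; rewrite /same_block -!eq_pblock ?part_trivIset ?mem_cover_part //.
Qed.

Lemma same_block_trans p : transitive (same_block p).
Proof.
move=> y x z xy; have [_ /(_ xy) ->] := same_block_equiv p x y z.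
by [].
Qed.

Lemma part_inj p q : same_block p =2 same_block q -> p = q.
Proof.
move=> pq; apply: val_inj => /=.
rewrite -(equivalence_partition_pblock (blocksP p)).
rewrite -(equivalence_partition_pblock (blocksP q)).
apply: eq_in_imset => x _; apply/setP=> y.
by rewrite !inE /= [_ \in _]pq.
Qed.

Lemma refinesP p q :
  reflect (subrel (same_block p) (same_block q)) (refines p q).
Proof.
apply: (iffP idP) => [/forall_inP pq x y xy | pq].
  have qx : pblock q x \in blocks q by rewrite pblock_mem ?mem_cover_part.
  have /existsP[C /andP[/subsetP Cp /eqP defB]] := pq _ qx.
  have : x \in cover C by rewrite -defB mem_pblock mem_cover_part.
  case/bigcupP => A AC xA; rewrite /same_block defB; apply/bigcupP; exists A => //.
  by move: xy; rewrite /same_block (def_pblock (part_trivIset p) (Cp _ AC) xA).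
apply/forall_inP => B Bq; apply/existsP; exists [set pblock p x | x in B].
apply/andP; split.
  by apply/subsetP=> _ /imsetP[x _ ->]; rewrite pblock_mem ?mem_cover_part.
apply/eqP/setP=> y; apply/idP/bigcupP => [yB | [_ /imsetP[x xB ->] /pq]].
  exists (pblock p y); first exact: imset_f.
  by rewrite mem_pblock mem_cover_part.
by rewrite /same_block (def_pblock (part_trivIset q) Bq xB).
Qed.

Fact refines_refl : reflexive refines.
Proof. by move=> p; apply/refinesP. Qed.

Fact refines_anti : antisymmetric refines.
Proof.
move=> p q /andP[/refinesP pq /refinesP qp]; apply: part_inj => x y.
by apply/idP/idP; [apply: pq | apply: qp].
Qed.

Fact refines_trans : transitive refines.
Proof.
move=> q p r /refinesP pq /refinesP qr; apply/refinesP => x y /pq; exact: qr.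
Qed.

HB.instance Definition _ :=
  Order.Le_isPOrder.Build (Order.Disp tt tt) (part U)
    refines_refl refines_anti refines_trans.

Lemma part_leP p q : reflect (subrel (same_block p) (same_block q)) (p <= q).
Proof. exact: refinesP. Qed.

Section OfEquivalence.

Variables (e : rel U) (e_equiv : equivalence_rel e).

Let e_equiv_in : {in [set: U] & &, equivalence_rel e}.
Proof. by move=> x y z _ _ _; apply: e_equiv. Qed.

Definition part_of : part U := Part (equivalence_partitionP e_equiv_in).

Lemma same_block_part_of : same_block part_of =2 e.
Proof.
by move=> x y; rewrite /same_block (pblock_equivalence_partition e_equiv_in) ?inE.
Qed.

End OfEquivalence.

Definition meet_rel p q : rel U :=
  fun x y => same_block p x y && same_block q x y.

Fact meet_rel_equiv p q : equivalence_rel (meet_rel p q).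
Proof.
move=> x y z; rewrite /meet_rel !same_block_refl; split=> // /andP[pxy qxy].
have [_ /(_ pxy) ->] := same_block_equiv p x y z.
by have [_ /(_ qxy) ->] := same_block_equiv q x y z.
Qed.

Definition part_meet p q := part_of (meet_rel_equiv p q).

Definition join_rel p q : rel U :=
  connect (fun x y => same_block p x y || same_block q x y).

Fact join_rel_equiv p q : equivalence_rel (join_rel p q).
Proof.
apply/equivalence_relP; split=> [x|x y xy z]; first exact: connect0.
have symE : connect_sym (fun x y => same_block p x y || same_block q x y).
  by apply: relU_sym; apply: sym_connect_sym; apply: same_block_sym.
exact: (same_connect symE xy).
Qed.

Definition part_join p q := part_of (join_rel_equiv p q).

Fact part_meetP p q r : (p <= part_meet q r) = (p <= q) && (p <= r).
Proof.
apply/part_leP/andP => [pqr | [/part_leP pq /part_leP pr] x y pxy].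
  by split; apply/part_leP=> x y /pqr; rewrite same_block_part_of => /andP[].
by rewrite same_block_part_of /meet_rel pq ?pr.
Qed.

Fact part_joinP p q r : (part_join p q <= r) = (p <= r) && (q <= r).
Proof.
apply/part_leP/andP => [pqr | [/part_leP pr /part_leP qr] x y].
  by split; apply/part_leP=> x y xy; apply: pqr; rewrite same_block_part_of;
     apply: connect1; rewrite /= xy ?orbT.
rewrite same_block_part_of => /connectP[s]; elim: s x => [|z s IHs] x /=.
  by move=> _ ->; apply: same_block_refl.
case/andP=> xz zs ylast; apply: same_block_trans (IHs _ zs ylast).
by case/orP: xz => [/pr | /qr].
Qed.

HB.instance Definition _ :=
  Order.POrder_MeetJoin_isLattice.Build (Order.Disp tt tt) (part U)
    part_meetP part_joinP.

Definition singletons : {set {set U}} := [set [set x] | x in [set: U]].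

Fact singletons_partition : partition singletons [set: U].
Proof.
apply/and3P; split.
- apply/eqP/setP=> x; rewrite inE; apply/bigcupP; exists [set x]; last exact: set11.
  exact: imset_f.
- apply/trivIsetP=> _ _ /imsetP[x _ ->] /imsetP[y _ ->] xy.
  by rewrite disjoints1 inE; apply: contraNneq xy => ->.
- by apply/imsetP=> -[x _ /setP/(_ x)]; rewrite !inE eqxx.
Qed.

Definition part_bot : part U := Part singletons_partition.

Fact part_le0 p : part_bot <= p.
Proof.
apply/part_leP=> x y; rewrite /same_block.
have xs : [set x] \in singletons by apply: imset_f.
rewrite (def_pblock (part_trivIset part_bot) xs (set11 x)) inE => /eqP ->.
exact: same_block_refl.
Qed.

HB.instance Definition _ :=
  Order.hasBottom.Build (Order.Disp tt tt) (part U) part_le0.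

End PartitionLattice.

Section BooleanSublattice.

Context {disp : Order.disp_t} {L : latticeType disp}.
Implicit Types S : {pred L}.

Definition sublattice S : Prop :=
  {in S &, forall x y, x `&` y \in S /\ x `|` y \in S}.

(* For a sublattice S, this says that S with the induced operations is
   distributive, bounded and complemented; the bounds b and t are those of S
   and need not be bounds of L. *)
Definition boolean_on S : Prop :=
  {in S & &, forall x y z, x `&` (y `|` z) = (x `&` y) `|` (x `&` z)} /\
  exists b t : L,
    [/\ b \in S, t \in S, {in S, forall x, b <= x <= t}
      & {in S, forall x, exists2 y, y \in S & x `&` y = b /\ x `|` y = t}].

Definition boolean_sublattice S : Prop := sublattice S /\ boolean_on S.

End BooleanSublattice.

Section Hypergraph.

Context {U : finType}.
Implicit Types (D X Y : {set part U}) (E : {set {set U}}) (u v : U).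

Definition disjoint_system D : Prop :=
  D != set0 /\ {in D &, forall p q, p != q -> p `&` q = \bot}.

(* As U is finite, every subset of D is finite. *)
Definition finite_joins D : {set part U} :=
  [set \join_(p in X) p | X : {set part U} in powerset D & X != set0].

Definition hyperedges D : {set {set U}} :=
  [set A : {set U} | (#|A| != 1) && [exists p in D, A \in blocks p]].

(* The path u, A_1, v_1, ..., A_n, v_n is encoded by its starting point u and
   the sequence s = [:: (A_1, v_1); ...; (A_n, v_n)]; the set0 paired with u
   below is a dummy. *)
Definition hyperpath E u v (s : seq ({set U} * U)) : bool :=
  [&& 0 < size s,
      path (fun a b : {set U} * U => (a.2 \in b.1) && (b.2 \in b.1))
           (set0, u) s,
      all (fun a => a.1 \in E) s,
      last u (unzip2 s) == v,
      uniq (u :: unzip2 s)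
    & uniq (unzip1 s)]%N.

Definition blocks_from X (s : seq ({set U} * U)) : bool :=
  all (fun a => [exists p in X, a.1 \in blocks p]) s.

Definition circuit_condition D : Prop :=
  forall X Y, X \subset D -> Y \subset D ->
  forall u v, u != v ->
  forall s t,
    hyperpath (hyperedges D) u v s -> blocks_from X s ->
    hyperpath (hyperedges D) u v t -> blocks_from Y t ->
  exists r, hyperpath (hyperedges D) u v r /\ blocks_from (X :&: Y) r.

End Hypergraph.

(* Main.v *)
(* Write J(X) for the join of a set X of partitions.  Two distinct vertices lie in
   the same block of J(X) iff a path using only blocks of members of X joins them,
   so the circuit condition says exactly that J(X) meet J(Y) = J(X :&: Y) for all
   X, Y \subset D.  Given this identity, J is a lattice morphism from the powerset
   of D onto the set of joins, which is thus Boolean.  Conversely, if the set of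
   joins is a distributive lattice, then J(X) meet J(Y) is the join of the p meet q
   with p in X and q in Y, and these are bottom unless p = q. *)
Require Import Defs.
From mathcomp Require Import all_boot all_order.

Set Implicit Arguments.
Unset Strict Implicit.
Unset Printing Implicit Defensive.

Import Order.Theory.

Local Open Scope order_scope.

Section Joins.

Variable U : finType.
Implicit Types (p q : part U) (D X Y Z : {set part U}) (u v w : U).
Implicit Types (A : {set U}) (a b : {set U} * U) (s r : seq ({set U} * U)).

Let step a b := (a.2 \in b.1) && (b.2 \in b.1).

Lemma same_block_mem p A u v : A \in blocks p -> u \in A -> v \in A ->
  same_block p u v.
Proof. by move=> Ap uA vA; rewrite /same_block (def_pblock (part_trivIset p) Ap uA). Qed.

Definition joinD X : part U := \join_(p in X) p.

Lemma le_joinD p X : p \in X -> p <= joinD X.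
Proof. exact: joins_sup. Qed.

Lemma joinDU X Y : joinD (X :|: Y) = joinD X `|` joinD Y.
Proof. exact: joins_setU. Qed.

Lemma joinD_subset X Y : X \subset Y -> joinD X <= joinD Y.
Proof. by move=> /subsetP XY; apply/joinsP => p /XY; apply: le_joinD. Qed.

Definition adj X : rel U := fun u v => [exists p in X, same_block p u v].

Lemma connect_adj_equiv X : equivalence_rel (connect (adj X)).
Proof.
apply/equivalence_relP; split=> [u|u v uv w]; first exact: connect0.
apply: (same_connect _ uv); apply: sym_connect_sym => x y.
by apply: eq_existsb => p; rewrite same_block_sym.
Qed.

(** The connected components of [adj X] form a partition above every member of [X], hence above the
    least upper bound [joinD X]. *)
Lemma same_block_joinD X : subrel (same_block (joinD X)) (connect (adj X)).
Proof.
move=> u v uv; rewrite -(same_block_part_of (connect_adj_equiv X)).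
suff /part_leP: joinD X <= part_of (connect_adj_equiv X) by apply.
apply/joinsP => p pX; apply/part_leP => x y xy; rewrite same_block_part_of.
by apply/connect1/exists_inP; exists p.
Qed.

Lemma hyperpath_same_block X u v s :
  hyperpath (hyperedges X) u v s -> same_block (joinD X) u v.
Proof.
case/and5P=> _ us sX /eqP slast _.
suff walk a : path step a s -> all (fun b => b.1 \in hyperedges X) s ->
    last a.2 (unzip2 s) = v -> same_block (joinD X) a.2 v by exact: (walk (set0, u)).
elim: s a {us sX slast} => [|b s IHs] a /=; first by move=> _ _ <-; apply: same_block_refl.
case/andP=> /andP[ab bb] bs /andP[bX sX] slast.
apply: same_block_trans (IHs b bs sX slast).
move: bX; rewrite inE => /andP[_ /exists_inP[p pX bp]].
by move/le_joinD/part_leP: pX; apply; apply: same_block_mem bp _ _.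
Qed.

(** A first approximation to a path: vertices and blocks may repeat, and singleton blocks may occur.
    [walk_hyperpath] prunes such a walk. *)
Lemma connect_walk X u v : connect (adj X) u v ->
  exists s, [/\ path step (set0, u) s, blocks_from X s & last u (unzip2 s) = v].
Proof.
case/connectP=> t; elim: t u => [|w t IHt] u /=; first by move=> _ ->; exists [::].
case/andP=> /exists_inP[p pX uw] wt vlast.
have [s [ws sX slast]] := IHt w wt vlast.
have Ap : pblock p u \in blocks p by rewrite pblock_mem ?mem_cover_part.
exists ((pblock p u, w) :: s); split=> //=.
- rewrite {1}/step /= mem_pblock mem_cover_part [w \in _]uw /=.
  by case: s ws {sX slast}.
- by rewrite sX andbT; apply/exists_inP; exists p.
Qed.

(* Only the last edge through u is kept: no later edge contains u, so neither that
   edge nor u itself can be repeated afterwards. *)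
Lemma walk_hyperpath X u v s : sorted step s -> all (fun a => a.2 \in a.1) s ->
    blocks_from X s -> last u (unzip2 s) = v -> has (fun a => u \in a.1) s ->
    u != v ->
  exists2 r, hyperpath (hyperedges X) u v r & {subset unzip1 r <= unzip1 s}.
Proof.
(* The start [u] enters only through [has] and the default of [last], so the induction may skip
   edges. As [sorted] leaves the vertex of the first entry unchecked, its membership is a separate
   hypothesis. *)
elim: s u => //= -[A w] s IHs u /= ws /andP[wA sm] /andP[AX sX] slast.
have sss : sorted step s by apply: path_sorted ws.
have [us _ uv|nus] := boolP (has (fun a => u \in a.1) s).
  have ulast : last u (unzip2 s) = v by case: (s) us slast.
  have [r rP rs] := IHs u sss sm sX ulast us uv.
  by exists r => // B /rs; rewrite inE orbC => ->.
rewrite orbF => uA uv.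
(* If [u] were [w], it would lie in the next edge, or equal [v] when no edge is left. *)
have uw : u != w.
  apply: contraNneq nus => uw; move: slast ws.
  by case: (s) => [/= vw|b s' _ /=]; [rewrite uw vw eqxx in uv | case/andP=> /andP[/=]; rewrite uw => ->].
have AE : A \in hyperedges X.
  rewrite inE AX andbT; apply/cards1P => -[x Ax].
  by move: uA wA uw; rewrite Ax !inE => /eqP-> /eqP->; rewrite eqxx.
have [wv|wv] := eqVneq w v.
  exists [:: (A, w)]; last by move=> B /=; rewrite !inE => ->.
  by rewrite /hyperpath /= uA wA AE wv eqxx inE uv.
have hw : has (fun a => w \in a.1) s.
  case: (s) slast ws => [/= vw|b s' _ /=]; first by rewrite vw eqxx in wv.
  by case/andP=> /andP[/= ->].
have [r /and5P[r0 wr rE rl /andP[rv re]] rs] := IHs w sss sm sX slast hw wv.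
exists ((A, w) :: r); last first.
  by move=> B /=; rewrite !inE => /orP[-> // | /rs ->]; rewrite orbT.
have nur B : B \in unzip1 r -> u \notin B.
  by move=> /rs /mapP[a as_ ->]; apply: contra nus => ua; apply/hasP; exists a.
apply/and5P; split=> //=.
- rewrite uA wA /=; by case: (r) wr.
- by rewrite AE.
- apply/andP; split; last by rewrite re andbT; apply/negP => /nur; rewrite uA.
  rewrite [X in _ && X]rv andbT inE negb_or uw; apply/mapP => -[a ar ua].
  have := nur a.1 (map_f _ ar); rewrite ua; apply/negP; rewrite negbK.
  (* Along a path each vertex lies in the edge paired with it, so a return to [u] would put [u] in
     an edge of [r], hence of [s]. *)
  elim: (r) (set0, w) wr ar => //= c r' IHr b /andP[/andP[_ cc] cr'].
  by rewrite inE => /predU1P[-> | /(IHr _ cr')].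
Qed.

Lemma same_block_joinDP X u v : u != v ->
  same_block (joinD X) u v <-> exists s, hyperpath (hyperedges X) u v s.
Proof.
move=> uv; split=> [/same_block_joinD/connect_walk[s [us sX slast]]|[s]]; last first.
  exact: hyperpath_same_block.
have sm : all (fun a => a.2 \in a.1) s.
  elim: s (set0, u) us {sX slast} => //= b s IHs a /andP[/andP[_ ->]]; exact: IHs.
have hu : has (fun a => u \in a.1) s.
  case: s us slast {sX sm} => [_ /= vu|b s /= /andP[/andP[/= -> //]]].
  by rewrite vu eqxx in uv.
have [r rP _] := walk_hyperpath (path_sorted us) sm sX slast hu uv.
by exists r.
Qed.

(** Translates between the paths of the circuit condition, taken in the hypergraph of [D], and those
    that describe [joinD X]. *)
Lemma hyperpath_subset D X u v s : X \subset D ->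
  hyperpath (hyperedges X) u v s =
  hyperpath (hyperedges D) u v s && blocks_from X s.
Proof.
move=> /subsetP XD; rewrite /hyperpath; have -> : all (fun a => a.1 \in hyperedges X) s =
    all (fun a => a.1 \in hyperedges D) s && blocks_from X s.
  rewrite -all_predI; apply: eq_all => a; rewrite !inE /=.
  case: (_ == 1%N) => //=; apply/idP/andP=> [aX|[] //]; split=> //.
  by case/exists_inP: aX => p /XD pD ap; apply/exists_inP; exists p.
by rewrite -!andbA; do 3!congr (_ && _); rewrite andbC -!andbA.
Qed.

Lemma circuit_conditionP D : circuit_condition D <->
  forall X Y, X \subset D -> Y \subset D -> joinD X `&` joinD Y = joinD (X :&: Y).
Proof.
split=> [circ X Y XD YD|meetJ X Y XD YD u v uv s t sD sX tD tY].
- apply/le_anti/andP; split; last first.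
    by rewrite lexI !joinD_subset ?subsetIl ?subsetIr.
  have XYD : X :&: Y \subset D by apply: subset_trans (subsetIl _ _) XD.
  apply/part_leP => u v.
  rewrite same_block_part_of => /andP[uXv uYv].
  have [<-|uv] := eqVneq u v; first exact: same_block_refl.
  have [s] := (same_block_joinDP X uv).1 uXv.
  have [t] := (same_block_joinDP Y uv).1 uYv.
  rewrite (hyperpath_subset _ _ _ YD) (hyperpath_subset _ _ _ XD).
  move=> /andP[tD tY] /andP[sD sX].
  have [r [rD rXY]] := circ X Y XD YD u v uv s t sD sX tD tY.
  apply/(same_block_joinDP _ uv); exists r.
  by rewrite (hyperpath_subset _ _ _ XYD) rD.
- have XYD : X :&: Y \subset D by apply: subset_trans (subsetIl _ _) XD.
  have: same_block (joinD (X :&: Y)) u v.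
    rewrite -meetJ // same_block_part_of; apply/andP; split.
      by apply: (@hyperpath_same_block _ _ _ s); rewrite (hyperpath_subset _ _ _ XD) sD.
    by apply: (@hyperpath_same_block _ _ _ t); rewrite (hyperpath_subset _ _ _ YD) tD.
  case/(same_block_joinDP _ uv) => r; rewrite (hyperpath_subset _ _ _ XYD).
  by case/andP; exists r.
Qed.

(** The empty join is [\bot], so adjoining [\bot] lifts the nonemptiness condition on [X]. *)
Lemma finite_joinsP D q :
  reflect (exists2 X : {set part U}, X \subset D & q = joinD X)
          (q \in \bot |: finite_joins D).
Proof.
rewrite !inE; apply: (iffP orP) => [[/eqP->|/imsetP[X]]|[X XD ->]].
- by exists set0; rewrite ?sub0set // /joinD big_set0.
- by rewrite inE powersetE => /andP[XD _] ->; exists X.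
- have [->|X0] := eqVneq X set0; first by left; rewrite /joinD big_set0.
  by right; apply/imsetP; exists X => //; rewrite inE powersetE XD.
Qed.

Lemma boolean_joinD D :
    (forall X Y, X \subset D -> Y \subset D ->
       joinD X `&` joinD Y = joinD (X :&: Y)) ->
  boolean_sublattice [in \bot |: finite_joins D].
Proof.
move=> meetJ; split=> [p q /finite_joinsP[X XD ->] /finite_joinsP[Y YD ->]|].
  split; apply/finite_joinsP.
    by exists (X :&: Y); rewrite ?meetJ // (subset_trans (subsetIl _ _)).
  by exists (X :|: Y); rewrite ?joinDU // subUset XD.
split=> [_ _ _ /finite_joinsP[X XD ->] /finite_joinsP[Y YD ->]
               /finite_joinsP[Z ZD ->]|].
  by rewrite -joinDU !meetJ // ?subUset ?YD // setIUr joinDU.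
exists \bot, (joinD D); split.
- by rewrite !inE eqxx.
- by apply/finite_joinsP; exists D.
- by move=> _ /finite_joinsP[X XD ->]; rewrite le0x joinD_subset.
(* Complements come from set complements in [D]. *)
- move=> _ /finite_joinsP[X XD ->]; exists (joinD (D :\: X)).
    by apply/finite_joinsP; exists (D :\: X); rewrite ?subsetDl.
  have XUD : X :|: D :\: X = D by rewrite -{1}(setIidPr XD) setID.
  by rewrite meetJ ?subsetDl // -joinDU XUD setIDA setDIl setDv set0I /joinD big_set0.
Qed.

Lemma meet_joinD D X Y :
    {in D &, forall p q, p != q -> p `&` q = \bot} ->
    boolean_sublattice [in \bot |: finite_joins D] ->
    X \subset D -> Y \subset D ->
  joinD X `&` joinD Y = joinD (X :&: Y).
Proof.
move=> disj [closed [distr _]] XD YD.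
have inS Z : Z \subset D -> joinD Z \in [in \bot |: finite_joins D].
  by move=> ZD; apply/finite_joinsP; exists Z.
have inD p : p \in D -> p \in [in \bot |: finite_joins D].
  by move=> pD; apply/finite_joinsP; exists [set p]; rewrite ?sub1set // /joinD big_set1.
have meet_le c d Z : c \in [in \bot |: finite_joins D] -> Z \subset D ->
    {in Z, forall p, c `&` p <= d} -> c `&` joinD Z <= d.
  move=> cS /subsetP ZD cZ.
  (* Distributivity holds only inside the sublattice, so the induction also carries the membership
     of the partial joins. *)
  suff [] : joinD Z \in [in \bot |: finite_joins D] /\ c `&` joinD Z <= d by [].
  rewrite /joinD; elim/big_rec: _ => [|p r pZ [rS cr]].
    by rewrite meetx0 le0x; split=> //; rewrite !inE eqxx.
  have pS := inD p (ZD p pZ); split; first by case: (closed p r pS rS).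
  by rewrite distr // leUx cZ.
apply/le_anti/andP; split; last first.
  by rewrite lexI !joinD_subset ?subsetIl ?subsetIr.
(* Distributing over [Y], then over [X], leaves the meets of single members [q] and [p]. *)
apply: (meet_le _ _ _ (inS X XD) YD) => q qY.
have qD := subsetP YD q qY; rewrite meetC.
apply: (meet_le _ _ _ (inD q qD) XD) => p pX.
have pD := subsetP XD p pX.
have [pq|qp] := eqVneq q p; last by rewrite disj ?le0x.
by rewrite pq meetxx le_joinD // inE pX -pq.
Qed.

End Joins.

Theorem theorem3p5 (U : finType) (U_nonempty : (0 < #|U|)%N)
    (D : {set part U}) (D_nonbot : \bot \notin D)
    (D_disjoint : disjoint_system D) :
  boolean_sublattice [in \bot |: finite_joins D] <-> circuit_condition D.
Proof.
split=> [boolD|/circuit_conditionP]; last exact: boolean_joinD.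
by apply/circuit_conditionP => X Y; apply: meet_joinD => //; case: D_disjoint.
Qed.
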